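(* Let $(x_k)_{k\ge1}\subset M$ be a sequence generated by the Riemannian adaptive scheme (described in the context). Suppose: (A1) $\mathbb{E}_k[\operatorname{grad} f_{s_{k,i}}(x_k)]=\operatorname{grad} f(x_k)$ for all $k\ge1$ and $i=1,\dots,b_k$; (A2) there is $\sigma^2>0$ with $\mathbb{E}_k[\|\operatorname{grad} f_{s_{k,i}}(x_k)-\operatorname{grad} f(x_k)\|_2^2]\le\sigma^2$ for all $k\ge1$ and $i=1,\dots,b_k$; (A3) there are $G,B>0$ with $\|\operatorname{grad} f(x_k)\|_2\le G$ and $\|\operatorname{grad} f_{B_k}(x_k)\|_2\le B$ for all $k\ge1$; (A4) there is $L>0$ with $|\mathrm{D}(f\circ R_x)(\eta)[\eta]-\mathrm{D}f(x)[\eta]|\le L\|\eta\|_2^2$ for all $x\in M$, $\eta\in T_xM$; (A5) $f$ is bounded below by $f_\star\in\mathbb{R}$. Assume moreover that, for all $k\ge1$, $\alpha_{k+1}\le\alpha_k$, $\phi_k(g_1,\dots,g_k)=g_k$ and $\alpha_kH_k^{-1}\succeq\alpha_{k+1}H_{k+1}^{-1}$, and that there exist $\mu,\nu>0$ such that $\mu I_d\preceq H_k^{-1}\preceq\nu I_d$ for all $k\ge1$. Assume that the diminishing step size $\alpha_k:=\alpha/\sqrt{k}$ satisfies $\alpha\in(0,1]$ and that the mini-batch size $b_k:=b$ satisfies $0<b\le N$. Then $$\frac1K\sum_{k=1}^K\mathbb{E}\left[\|\operatorname{grad} f(x_k)\|_2^2\right]=\mathcal{O}\left(\left(1+\frac1b\right)\frac{\log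 K}{\sqrt K}\right).$$
   Context: Geometry. $M$ is an embedded submanifold of $\mathbb{R}^d$ with the Riemannian metric induced by $\langle x,y\rangle_2=x^\top y$ (norm $\|\cdot\|_2$); each tangent space $T_xM$ is regarded as a linear subspace of $\mathbb{R}^d$, and $P_x:\mathbb{R}^d\to T_xM$ is the orthogonal projection. $\operatorname{grad}$ is the Riemannian gradient: $\langle\operatorname{grad} f(x),\eta\rangle_2=\mathrm{D}f(x)[\eta]$ for all $\eta\in T_xM$. A retraction is a smooth map $R:TM\to M$ whose restriction $R_x$ to $T_xM$ satisfies $R_x(0_x)=x$ and $\mathrm{D}R_x(0_x)=\mathrm{id}_{T_xM}$ for all $x\in M$. $X\preceq Y$ (equivalently $Y\succeq X$) means $Y-X$ is positive semidefinite; $I_d$ is the $d\times d$ identity matrix. $\mathcal{O}$ is Landau's symbol: for a sequence $(a_k)$, $a_k=\mathcal{O}(g(k))$ as $k\to\infty$ if there exist a constant $C>0$ and an index $k_0$ such that $|a_k|\le C|g(k)|$ for all $k\ge k_0$. Problem and sampling. $f:M\to\mathbb{R}$, $f=\frac1N\sum_{i=1}^N f_i$ with $f_i:M\to\mathbb{R}$ smooth. $b_k$ ($\le N$) is the batch size at iteration $k$. $s_{k,i}$ is the random variable (an index in $\{1,\dots,N\}$) generated from the $i$-th sampling at the $k$-th iteration, and $\boldsymbol{s}_k=(s_{k,1},\dots,s_{k,b_k})^\top$. The vectors $\boldsymbol{s}_1,\boldsymbol{s}_2,\dots$ are independent, and $\boldsymbol{s}_k$ is independent of the iterates $x_1,\dots,x_k$.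 $\mathbb{E}_k$ denotes expectation with respect to $\boldsymbol{s}_k$, and the total expectation $\mathbb{E}$ is $\mathbb{E}_1\mathbb{E}_2\cdots\mathbb{E}_k$. The mini-batch gradient is $\operatorname{grad} f_{B_k}(x_k)=\frac1{b_k}\sum_{i=1}^{b_k}\operatorname{grad} f_{s_{k,i}}(x_k)$. Riemannian adaptive scheme. Given an initial point $x_1\in M$, a retraction $R$, step sizes $\alpha_k>0$, and maps $\phi_k:T_{x_1}M\times\cdots\times T_{x_k}M\to\mathbb{R}^d$ and $\psi_k$ from $T_{x_1}M\times\cdots\times T_{x_k}M$ to the diagonal positive definite $d\times d$ matrices, for $k=1,2,\dots$: $g_k=\operatorname{grad} f_{B_k}(x_k)$, $m_k=\phi_k(g_1,\dots,g_k)$, $H_k=\psi_k(g_1,\dots,g_k)$, $x_{k+1}=R_{x_k}(-\alpha_kP_{x_k}(H_k^{-1}m_k))$. *)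

(* Defs.v *)
From HB Require Import structures.
From mathcomp Require Import all_boot all_order all_algebra finmap.
From mathcomp Require Import all_classical all_reals all_analysis.

Set Implicit Arguments.
Unset Strict Implicit.
Unset Printing Implicit Defensive.

Import Order.TTheory GRing.Theory Num.Theory numFieldNormedType.Exports.

Local Open Scope classical_set_scope.
Local Open Scope ring_scope.

(* Euclidean structure: the library norm on matrices is the max norm, so the
   norm ||.||_2 is defined separately; both induce the same topology. *)

Definition dot (R : realType) (d : nat) (u v : 'cV[R]_d) : R :=
  (u^T *m v) 0 0.

Definition norm2 (R : realType) (d : nat) (u : 'cV[R]_d) : R :=
  Num.sqrt (dot u u).

(* All the spaces V below are finite dimensional: f is then C^n.+1 on an open
   set iff it is differentiable there and all its directional derivatives are
   C^n. *)
Fixpoint Ck (R : realType) (V W : normedModType R) (n : nat)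
    (U : set V) (f : V -> W) : Prop :=
  if n is n'.+1
  then (forall x, U x -> differentiable f x) /\
       (forall v, Ck n' U (fun x => 'D_v f x))
  else forall x, U x -> {for x, continuous f}.

Definition smooth (R : realType) (V W : normedModType R)
    (U : set V) (f : V -> W) : Prop :=
  forall n, Ck n U f.

(* Smoothness on a subset that need not be open, such as an embedded
   submanifold: existence of local smooth extensions. *)
Definition smooth_on (R : realType) (V W : normedModType R)
    (A : set V) (f : V -> W) : Prop :=
  forall x, A x -> exists (U : set V) (F : V -> W),
    [/\ open U, U x, smooth U F & forall y, U y -> A y -> F y = f y].

(* Slice charts: a diffeomorphism F : U -> U' between open subsets of R^d
   mapping M `&` U onto U' `&` (R^n x {0}). *)
Definition embedded_submanifold (R : realType) (d n : nat)
    (M : set 'cV[R]_d) : Prop :=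
  (n <= d)%N /\
  forall x, M x ->
    exists (U U' : set 'cV[R]_d) (F F' : 'cV[R]_d -> 'cV[R]_d),
      [/\ [/\ open U, U x & open U'],
          smooth U F /\ smooth U' F',
          (forall y, U y -> U' (F y) /\ F' (F y) = y),
          (forall z, U' z -> U (F' z) /\ F (F' z) = z) &
          forall y, U y ->
            (M y <-> forall i : 'I_d, (n <= i)%N -> F y i 0 = 0)].

Definition curve_through (R : realType) (d : nat) (M : set 'cV[R]_d)
    (x v : 'cV[R]_d) (c : R -> 'cV[R]_d) : Prop :=
  (exists2 e : R, 0 < e &
     smooth [set t : R^o | `|t| < e] c /\ (forall t, `|t| < e -> M (c t))) /\
  c 0 = x /\ is_derive (0 : R^o) (1 : R^o) c v.

Definition tangent (R : realType) (d : nat) (M : set 'cV[R]_d)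
    (x : 'cV[R]_d) : set 'cV[R]_d :=
  [set v | exists c, curve_through M x v c].

Definition tangent_bundle (R : realType) (d : nat) (M : set 'cV[R]_d) :
    set ('cV[R]_d * 'cV[R]_d) :=
  [set p | M p.1 /\ tangent M p.1 p.2].

(* D f(x)[v] = (f \o c)'(0) for any curve c in M through x with velocity v. *)
Definition mdiff (R : realType) (d : nat) (M : set 'cV[R]_d)
    (f : 'cV[R]_d -> R) (x v : 'cV[R]_d) : R :=
  xget 0 [set l : R | exists2 c, curve_through M x v c &
                      is_derive (0 : R^o) (1 : R^o) (f \o c : R^o -> R^o) l].

Definition grad (R : realType) (d : nat) (M : set 'cV[R]_d)
    (f : 'cV[R]_d -> R) (x : 'cV[R]_d) : 'cV[R]_d :=
  xget 0 [set g | tangent M x g /\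
                  forall v, tangent M x v -> dot g v = mdiff M f x v].

Definition tproj (R : realType) (d : nat) (M : set 'cV[R]_d)
    (x u : 'cV[R]_d) : 'cV[R]_d :=
  xget 0 [set p | tangent M x p /\
                  forall v, tangent M x v -> dot (u - p) v = 0].

(* R_x(v) is written [Rt x v]; only the values of Rt on TM are constrained. *)
Record retraction (R : realType) (d : nat) (M : set 'cV[R]_d)
    (Rt : 'cV[R]_d -> 'cV[R]_d -> 'cV[R]_d) : Prop := Retraction {
  retr_in : forall x v, tangent_bundle M (x, v) -> M (Rt x v);
  retr_smooth : smooth_on (tangent_bundle M)
    (fun p : 'cV[R]_d * 'cV[R]_d => Rt p.1 p.2);
  retr0 : forall x, M x -> Rt x 0 = x;
  retr_diff0 : forall x v, M x -> tangent M x v ->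
    is_derive (0 : 'cV[R]_d) v (Rt x) v
}.

Definition psdmx (R : realType) (d : nat) (A : 'M[R]_d) : Prop :=
  A^T = A /\ forall v : 'cV[R]_d, 0 <= dot v (A *m v).

Definition pdmx (R : realType) (d : nat) (A : 'M[R]_d) : Prop :=
  A^T = A /\ forall v : 'cV[R]_d, v != 0 -> 0 < dot v (A *m v).

Definition loewner_le (R : realType) (d : nat) (A B : 'M[R]_d) : Prop :=
  psdmx (B - A).

Definition avg_fun (R : realType) (d N : nat)
    (f : 'I_N -> 'cV[R]_d -> R) (x : 'cV[R]_d) : R :=
  N%:R^-1 * \sum_(i < N) f i x.

Definition minibatch_grad (R : realType) (d N b : nat) (M : set 'cV[R]_d)
    (f : 'I_N -> 'cV[R]_d -> R) (idx : 'I_b -> 'I_N) (x : 'cV[R]_d) :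
    'cV[R]_d :=
  b%:R^-1 *: \sum_(i < b) grad M (f (idx i)) x.

(* Iterations are numbered from 1, as are the histories (x_1, ..., x_k) and
   (g_1, ..., g_k) passed to phi k and psi k; the index 0 is unused. The domain
   T_{x_1}M x ... x T_{x_k}M depends on the base points, hence so may phi k and
   psi k. They are total functions, but are only evaluated, and psi k is only
   constrained, at tangent vectors. *)

Definition pd_diag_valued (R : realType) (d : nat) (M : set 'cV[R]_d)
    (psi : forall k, ('I_k -> 'cV[R]_d) -> ('I_k -> 'cV[R]_d) -> 'M[R]_d) :
    Prop :=
  forall k (xs gs : 'I_k -> 'cV[R]_d), (0 < k)%N ->
    (forall i, tangent_bundle M (xs i, gs i)) ->
    is_diag_mx (psi k xs gs) /\ pdmx (psi k xs gs).

Record adaptive_scheme (R : realType) (d N b : nat) (T : Type)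
    (M : set 'cV[R]_d) (f : 'I_N -> 'cV[R]_d -> R)
    (Rt : 'cV[R]_d -> 'cV[R]_d -> 'cV[R]_d) (alpha : nat -> R)
    (phi : forall k, ('I_k -> 'cV[R]_d) -> ('I_k -> 'cV[R]_d) -> 'cV[R]_d)
    (psi : forall k, ('I_k -> 'cV[R]_d) -> ('I_k -> 'cV[R]_d) -> 'M[R]_d)
    (s : nat -> 'I_b -> T -> 'I_N) (x1 : 'cV[R]_d)
    (x g m : nat -> T -> 'cV[R]_d) (H : nat -> T -> 'M[R]_d) : Prop :=
  AdaptiveScheme {
  scheme_init : forall w, x 1%N w = x1;
  scheme_g : forall k w, (0 < k)%N ->
    g k w = minibatch_grad M f (fun i => s k i w) (x k w);
  scheme_m : forall k w, (0 < k)%N ->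
    m k w = phi k (fun i => x i.+1 w) (fun i => g i.+1 w);
  scheme_H : forall k w, (0 < k)%N ->
    H k w = psi k (fun i => x i.+1 w) (fun i => g i.+1 w);
  scheme_x : forall k w, (0 < k)%N ->
    x k.+1 w =
    Rt (x k w) (- alpha k *: tproj M (x k w) (invmx (H k w) *m m k w))
}.

(* The family (X k)_{k in D} of discrete random variables is mutually
   independent. *)
Definition independent_family (dT : measure_display) (T : measurableType dT)
    (R : realType) (P : probability T R) (E : Type) (D : set nat)
    (X : nat -> T -> E) : Prop :=
  forall (J : {fset nat}) (A : nat -> set E), (forall k, k \in J -> D k) ->
    P (\bigcap_(k in [set` J]) (X k @^-1` A k)) =
    (\prod_(k <- J) P (X k @^-1` A k))%E.

(* The discrete random variable X is independent of the random vectors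
   Y_1, ..., Y_k; it is enough to test events of the form
   {Y_1 in C_1, ..., Y_k in C_k} with the C_i Borel, which form a pi-system
   generating sigma(Y_1, ..., Y_k). *)
Definition independent_of_past (dT : measure_display) (T : measurableType dT)
    (R : realType) (P : probability T R) (E : Type) (d k : nat)
    (X : T -> E) (Y : nat -> T -> 'cV[R]_d) : Prop :=
  forall (A : set E) (C : nat -> set 'cV[R]_d),
    (forall i, <<s open >> (C i)) ->
    P (X @^-1` A `&` \bigcap_(i in [set i | (1 <= i <= k)%N]) (Y i @^-1` C i)) =
    (P (X @^-1` A) *
     P (\bigcap_(i in [set i | (1 <= i <= k)%N]) (Y i @^-1` C i)))%E.

(* Main.v *)
Require Import Defs.
From HB Require Import structures.
From mathcomp Require Import all_boot all_order all_algebra finmap.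
From mathcomp Require Import all_classical all_reals all_analysis.
From mathcomp Require Import zify ring lra.

Set Implicit Arguments.
Unset Strict Implicit.
Unset Printing Implicit Defensive.

Import Order.TTheory GRing.Theory Num.Theory numFieldNormedType.Exports.

Local Open Scope classical_set_scope.
Local Open Scope ring_scope.

(* The batch indices are finite valued, so every iterate x_k, direction g_k and
   preconditioner H_k is a function of the finitely many histories of the
   batches: all expectations are finite sums and no measurability issue arises.
   Composing f with t |-> R_x(t eta) and applying the mean value theorem turns
   (A4) into a descent inequality. In it alpha_k H_k^{-1} is replaced by
   alpha_{k-1} H_{k-1}^{-1}, which does not depend on the k-th batch; the error
   is bounded by the trace of a positive semidefinite difference and telescopes.
   Summing, taking expectations and using (A1) bounds
   (alpha / sqrt K) mu sum_k E|grad f(x_k)|^2 by a constant plus a multiple of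
   sum_k alpha_k^2 = O(log K). *)

(** * Euclidean geometry and positive semidefinite matrices *)

Section EuclideanSpace.
Variables (R : realType) (d : nat).
Implicit Types (u v w : 'cV[R]_d) (A D : 'M[R]_d).

Lemma dotE u v : dot u v = \sum_i u i 0 * v i 0.
Proof. by rewrite /dot mxE; apply: eq_bigr => i _; rewrite mxE. Qed.

Lemma dotC u v : dot u v = dot v u.
Proof. by rewrite !dotE; apply: eq_bigr => i _; rewrite mulrC. Qed.

Lemma dotDr u v w : dot u (v + w) = dot u v + dot u w.
Proof. by rewrite /dot mulmxDr mxE. Qed.

Lemma dotZr (c : R) u v : dot u (c *: v) = c * dot u v.
Proof. by rewrite /dot -scalemxAr mxE. Qed.

Lemma dotNr u v : dot u (- v) = - dot u v.
Proof. by rewrite -scaleN1r dotZr mulN1r. Qed.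

Lemma dotBr u v w : dot u (v - w) = dot u v - dot u w.
Proof. by rewrite dotDr dotNr. Qed.

Lemma dotDl u v w : dot (u + v) w = dot u w + dot v w.
Proof. by rewrite !(dotC _ w) dotDr. Qed.

Lemma dotZl (c : R) u v : dot (c *: u) v = c * dot u v.
Proof. by rewrite !(dotC _ v) dotZr. Qed.

Lemma dotBl u v w : dot (u - v) w = dot u w - dot v w.
Proof. by rewrite !(dotC _ w) dotBr. Qed.

Lemma dot_deltal v (i : 'I_d) : dot (delta_mx i 0) v = v i 0.
Proof.
rewrite dotE (bigD1 i)//= big1 ?addr0 => [|j ji]; first by rewrite mxE !eqxx mul1r.
by rewrite mxE (negbTE ji) mul0r.
Qed.

Lemma dot_ge0 u : 0 <= dot u u.
Proof. by rewrite dotE sumr_ge0// => i _; rewrite -expr2 sqr_ge0. Qed.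

Lemma dot_eq0 u : (dot u u == 0) = (u == 0).
Proof.
apply/idP/eqP => [|->]; last by rewrite /dot mulmx0 mxE.
rewrite dotE psumr_eq0 => [/allP h|i _]; last by rewrite -expr2 sqr_ge0.
apply/matrixP => i j; rewrite ord1 mxE.
by have := h i (mem_index_enum i); rewrite mulf_eq0 orbb => /eqP.
Qed.

Lemma norm2_ge0 u : 0 <= norm2 u.
Proof. exact: sqrtr_ge0. Qed.

Lemma sqr_norm2 u : norm2 u ^+ 2 = dot u u.
Proof. by rewrite sqr_sqrtr// dot_ge0. Qed.

Lemma norm2Z (c : R) u : norm2 (c *: u) ^+ 2 = c ^+ 2 * norm2 u ^+ 2.
Proof. by rewrite !sqr_norm2 dotZl dotZr mulrA expr2. Qed.

Lemma ler_entry_norm2 u i : `|u i 0| <= norm2 u.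
Proof.
rewrite -sqrtr_sqr ler_wsqrtr// dotE (bigD1 i)//= -expr2 lerDl.
by rewrite sumr_ge0// => j _; rewrite -expr2 sqr_ge0.
Qed.

Lemma dot_mulmxE u D v : dot u (D *m v) = \sum_i \sum_j u i 0 * D i j * v j 0.
Proof.
rewrite dotE; apply: eq_bigr => i _; rewrite mxE mulr_sumr.
by apply: eq_bigr => j _; rewrite mulrA.
Qed.

Lemma dot_mulmx_delta D (i j : 'I_d) :
  dot (delta_mx i 0) (D *m delta_mx j 0) = D i j.
Proof.
rewrite dot_deltal mxE (bigD1 j)//= big1 ?addr0 => [|k kj].
  by rewrite mxE !eqxx mulr1.
by rewrite mxE (negbTE kj) mulr0.
Qed.

(** Testing the quadratic form on the sum and the difference of two basis vectors gives
    [2 |D i j| <= D i i + D j j], and each diagonal entry is at most the trace. *)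
Lemma psdmx_ler_tr D (i j : 'I_d) : psdmx D -> `|D i j| <= \tr D.
Proof.
move=> [Dsym Dpos].
have Dii k : 0 <= D k k by have := Dpos (delta_mx k 0); rewrite dot_mulmx_delta.
have Dtr k : D k k <= \tr D.
  by rewrite /mxtrace (bigD1 k)//= lerDl sumr_ge0.
have Dji : D j i = D i j by rewrite -{1}Dsym mxE.
have := Dpos (delta_mx i 0 + delta_mx j 0).
have := Dpos (delta_mx i 0 - delta_mx j 0).
rewrite !(mulmxBr, mulmxDr, dotBl, dotBr, dotDl, dotDr) !dot_mulmx_delta Dji.
have := Dtr i; have := Dtr j; rewrite ler_norml => h1 h2 h3 h4.
by apply/andP; split; lra.
Qed.

(** The [d ^ 2] entries are bounded one at a time. The constant is crude, but the bound is linear in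
    the trace, which is what telescopes later. *)
Lemma psdmx_dot_le D u v : psdmx D ->
  `|dot u (D *m v)| <= d%:R ^+ 2 * \tr D * norm2 u * norm2 v.
Proof.
move=> Dpsd; rewrite dot_mulmxE.
have le1 (i j : 'I_d) : `|u i 0 * D i j * v j 0| <= \tr D * norm2 u * norm2 v.
  rewrite !normrM ler_pM ?ler_entry_norm2// mulrC ler_pM ?ler_entry_norm2//.
  exact: psdmx_ler_tr.
apply: le_trans (ler_norm_sum _ _ _) _.
have : \sum_(i < d) `|\sum_(j < d) u i 0 * D i j * v j 0| <=
    \sum_(i < d) \sum_(j < d) (\tr D * norm2 u * norm2 v).
  by apply: ler_sum => i _; apply: le_trans (ler_norm_sum _ _ _) _; exact: ler_sum.
move=> /le_trans; apply.
by rewrite !sumr_const !card_ord -mulrnA -(mulr_natl (_ * _ * _)) natrM expr2 !mulrA.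
Qed.

(** Take [u = D *m v] in the previous bound and divide by the norm of [D *m v]. *)
Lemma psdmx_norm2_le D v : psdmx D ->
  norm2 (D *m v) <= d%:R ^+ 2 * \tr D * norm2 v.
Proof.
move=> Dpsd; have := psdmx_dot_le (D *m v) v Dpsd.
rewrite ger0_norm ?dot_ge0// -sqr_norm2 expr2 -mulrA.
have := norm2_ge0 (D *m v); rewrite le_eqVlt => /predU1P[<- _|h].
  rewrite !mulr_ge0 ?sqr_ge0 ?norm2_ge0//.
  by rewrite sumr_ge0// => i _; rewrite -dot_mulmx_delta; case: Dpsd.
by rewrite [norm2 _ * norm2 v]mulrC !mulrA ler_pM2r.
Qed.

(** The two matrices have the same left kernel: if [r *m A *m A^T = 0], then the squared norm of
    [r *m A] vanishes. *)
Lemma mxrank_mul_tr A : \rank (A *m A^T) = \rank A.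
Proof.
apply/eqP; rewrite eqn_leq mxrankM_maxl /=.
have /mxrankS : (kermx (A *m A^T) <= kermx A)%MS.
  apply/sub_kermxP/row_matrixP => i; rewrite row0 row_mul.
  set r := row i _.
  have r0 : r *m A *m A^T = 0 by rewrite -mulmxA -row_mul mulmx_ker row0.
  apply: trmx_inj; rewrite trmx0; apply/eqP; rewrite -dot_eq0 /dot trmxK trmx_mul.
  by rewrite mulmxA r0 mul0mx mxE.
rewrite !mxrank_ker.
by have := rank_leq_row A; have := rank_leq_row (A *m A^T); lia.
Qed.

(* The normal equation [A^T A c = A^T u] is solvable because [A^T A] and [A]
   have the same rank, hence the same row space. *)
Lemma orthogonal_projection_mx A u :
  exists c : 'cV[R]_d, forall e, dot (u - A *m c) (A *m e) = 0.
Proof.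
have rowE : (A <= A^T *m A)%MS.
  have := mxrank_mul_tr A^T; rewrite trmxK mxrank_tr => rkE.
  have [_ <-] := mxrank_leqif_sup (submxMl A^T A).
  by rewrite rkE.
have /submxP[r rE] := submx_trans (submxMl u^T A) rowE.
exists r^T => e.
rewrite /dot mulmxA (_ : (u - A *m r^T)^T *m A = 0) ?mul0mx ?mxE//.
by rewrite linearB /= trmx_mul trmxK mulmxBl rE mulmxA subrr.
Qed.

End EuclideanSpace.

Lemma psdmx_dot_mulmx (R : realType) d (A : 'M[R]_d) u v : psdmx A ->
  dot (A *m u) v = dot u (A *m v).
Proof. by move=> [Asym _]; rewrite /dot trmx_mul Asym mulmxA. Qed.

Lemma psdmx_tr_ge0 (R : realType) d (A : 'M[R]_d) : psdmx A -> 0 <= \tr A.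
Proof.
by move=> [_ Apos]; rewrite sumr_ge0// => i _; rewrite -dot_mulmx_delta.
Qed.

Lemma loewner_le_scalar_dot (R : realType) d (A : 'M[R]_d) (c : R) v :
  loewner_le c%:M A -> c * norm2 v ^+ 2 <= dot v (A *m v).
Proof.
move=> [_ /(_ v)]; rewrite mulmxBl dotBr mul_scalar_mx dotZr sqr_norm2.
by rewrite subr_ge0.
Qed.

Lemma loewner_le_scalar_psd (R : realType) d (A : 'M[R]_d) (c : R) :
  0 <= c -> loewner_le c%:M A -> psdmx A.
Proof.
move=> c0 cA; split=> [|v].
  by case: cA => + _; rewrite linearB /= tr_scalar_mx => /addIr.
by apply: le_trans (loewner_le_scalar_dot v cA); rewrite mulr_ge0// sqr_ge0.
Qed.

Lemma loewner_le_scalar_tr (R : realType) d (A : 'M[R]_d) (c : R) :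
  loewner_le A c%:M -> \tr A <= d%:R * c.
Proof.
move=> /psdmx_tr_ge0.
by rewrite linearB /= mxtrace_scalar mulr_natl subr_ge0.
Qed.

(** * Tangent spaces, gradients and the descent inequality *)

Section Lines.
Variables (R : realType) (V W : normedModType R).
Implicit Types (f : V -> W) (U : set V).

Lemma Ck_subset n U U' f : U' `<=` U -> Ck n U f -> Ck n U' f.
Proof.
elim: n f => [|n IHn] f UU' /=; first by move=> + x /UU' => /[apply].
by move=> [df Df]; split=> [x /UU' /df//|v]; exact: IHn.
Qed.

(** The two difference quotients agree for every increment, hence so do their limits, whether or not
    [f] is differentiable. *)
Lemma derive_line f (p w : V) (r t : R^o) :
  'D_r (fun s : R^o => f (p + s *: w)) t = 'D_(r *: w) f (p + t *: w).
Proof.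
rewrite /derive; apply: (congr1 (fun g : R -> W => lim (g h @[h --> 0^']))).
apply/funext => h; rewrite /shift /=; congr (_ *: (f _ - _)).
by rewrite scalerDl addrCA scalerA.
Qed.

Lemma differentiable_line (p w : V) (t : R^o) :
  differentiable (fun s : R^o => p + s *: w) t.
Proof. exact: ex_diff. Qed.

(** Induction on [n] for all [f] at once: the derivative of the restriction in direction [r] is the
    restriction of ['D_(r *: w) f]. *)
Lemma Ck_line n U f (p w : V) : Ck n U f ->
  Ck n [set t : R^o | U (p + t *: w)] (fun t : R^o => f (p + t *: w)).
Proof.
elim: n f => [|n IHn] f /=.
  move=> cf t Ut; apply: (@continuous_comp _ _ _ (fun s : R^o => p + s *: w) f).
    exact: (differentiable_continuous (differentiable_line p w t)).
  exact: cf Ut.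
move=> [df Df]; split=> [t Ut|r].
  exact: (differentiable_comp (differentiable_line p w t) (df _ Ut)).
rewrite (_ : (fun t => _) = (fun t : R^o => 'D_(r *: w) f (p + t *: w))).
  exact: (IHn (fun x => 'D_(r *: w) f x) (Df (r *: w))).
by apply/funext => t; exact: derive_line.
Qed.

Lemma smooth_differentiable U f x : smooth U f -> U x -> differentiable f x.
Proof. by move=> /(_ 1%N)[+ _] => /[apply]. Qed.

Lemma is_derive_line f (p w : V) : differentiable f p ->
  is_derive (0 : R^o) (1 : R^o) (fun s : R^o => f (p + s *: w)) ('d f p w).
Proof.
move=> df; have dl := differentiable_line p w 0.
apply: DeriveDef; last by rewrite derive_line scale0r addr0 scale1r deriveE.
apply/derivable1_diffP; apply: differentiable_comp dl _.
by rewrite scale0r addr0.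
Qed.

Lemma is_derive_along (c : R -> V) f x v : is_derive (0 : R^o) (1 : R^o) c v ->
  c 0 = x -> differentiable f x ->
  is_derive (0 : R^o) (1 : R^o) (f \o c) ('d f x v).
Proof.
move=> dc <- df; have dc0 : differentiable c (0 : R^o).
  by apply/derivable1_diffP; exact: ex_derive.
have dfc := differentiable_comp dc0 df.
apply: DeriveDef; first exact/derivable1_diffP.
by rewrite deriveE// diff_comp//= -(deriveE _ dc0) (@derive_val _ _ _ _ _ _ _ dc).
Qed.

End Lines.

Lemma linear_mulmx (R : realType) d (L : {linear 'cV[R]_d -> 'cV[R]_d}) :
  exists A : 'M[R]_d, forall v, L v = A *m v.
Proof.
exists (\matrix_(i, j) L (delta_mx j 0) i 0) => v.
rewrite {1}(matrix_sum_delta v) linear_sum; apply/matrixP => i j; rewrite ord1.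
rewrite summxE mxE; apply: eq_bigr => k _.
by rewrite big_ord1 linearZ !mxE mulrC.
Qed.

Lemma linear_dot (R : realType) d (L : {linear 'cV[R]_d -> R^o}) :
  exists r : 'cV[R]_d, forall v, L v = dot r v.
Proof.
exists (\col_i L (delta_mx i 0)) => v.
rewrite {1}(matrix_sum_delta v) linear_sum dotE; apply: eq_bigr => k _.
by rewrite big_ord1 linearZ !mxE mulrC.
Qed.

Section Tangent.
Variables (R : realType) (d n : nat) (M : set 'cV[R]_d).
Hypothesis hM : embedded_submanifold n M.
Variable x : 'cV[R]_d.
Hypothesis Mx : M x.

(* In a slice chart F with inverse F', T_x M is the image of R^n x {0} under
   DF'(F x). *)
Lemma tangent_image :
  exists A : 'M[R]_d, forall v, tangent M x v <-> exists c, v = A *m c.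
Proof.
have [nd /(_ x Mx)[U [U' [F [F' [[oU Ux oU'] [sF sF'] FK F'K MU]]]]]] := hM.
have [U'Fx F'Fx] := FK _ Ux.
have dF := smooth_differentiable sF Ux.
have dF' := smooth_differentiable sF' U'Fx.
have [A AE] := linear_mulmx ('d F' (F x)).
(* [E] keeps the first [n] coordinates, so the range of [A *m E] is the image of R^n x {0} under
   DF'(F x). *)
pose E : 'M[R]_d := \matrix_(i, j) ((i == j) && (i < n)%N)%:R.
have EE c i : (E *m c) i (0 : 'I_1) = (i < n)%:R * c i 0.
  rewrite mxE (bigD1 i)//= big1 ?addr0 => [|k ki]; first by rewrite mxE eqxx.
  by rewrite mxE eq_sym (negbTE ki) mul0r.
exists (A *m E) => v; split=> [[c [[e e0 [sc Mc]] [c0 dc]]]|[w ->]].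
  have dcF : is_derive (0 : R^o) (1 : R^o) (F \o c) ('d F x v).
    exact: is_derive_along.
  have cc : {for (0 : R^o), continuous c}.
    by apply: differentiable_continuous; apply/derivable1_diffP; exact: ex_derive.
  have Uc : \forall t \near (0 : R^o), U (c t).
    by apply: cc; rewrite c0; exact: open_nbhs_nbhs.
  have Mc0 : \forall t \near (0 : R^o), M (c t).
    near=> t; apply: Mc; near: t; exact: (@nbhs0_lt _ R^o).
  (* The coordinates of [F \o c] of index at least [n] vanish near 0, so [E] fixes DF(x)v; and DF'
     sends DF(x)v back to [v] because F' o F o c = c near 0. *)
  exists ('d F x v); rewrite -mulmxA.
  have -> : E *m 'd F x v = 'd F x v.
    apply/matrixP => i j; rewrite ord1 EE; case: ltnP => [_|ni].
      by rewrite mul1r.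
    rewrite mul0r; have dFc : derivable (F \o c) (0 : R^o) (1 : R^o).
      exact: ex_derive.
    rewrite -(@derive_val _ _ _ _ _ _ _ dcF) derive_mx// mxE.
    rewrite (near_eq_derive (g := cst 0)) ?derive_cst//.
    near=> t => /=; have Mct : M (c t) by near: t.
    by apply: (MU (c t) _).1 => //; near: t.
  rewrite -AE; apply: etrans (esym (@derive_val _ _ _ _ _ _ _ dc)) _.
  have dF'F : is_derive (0 : R^o) (1 : R^o) (F' \o (F \o c))
      ('d F' (F x) ('d F x v)).
    by apply: is_derive_along => //=; rewrite c0.
  apply: etrans (@derive_val _ _ _ _ _ _ _ dF'F).
  apply: near_eq_derive; near=> t.
  by rewrite /= (FK (c t) _).2//; near: t.
pose z := E *m w.
(* The curve is a straight line of the slice carried back to [M] by the inverse chart. *)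
exists (fun t => F' (F x + t *: z)); split; last first.
  split; first by rewrite scale0r addr0.
  by rewrite -mulmxA -AE; exact: is_derive_line.
have : \forall t \near (0 : R^o), U' (F x + t *: z).
  apply: (differentiable_continuous (differentiable_line (F x) z 0)).
  by rewrite scale0r addr0; exact: open_nbhs_nbhs.
move=> /nbhs_ballP[e /= e0 eU']; have {}eU' t : `|t| < e -> U' (F x + t *: z).
  by move=> te; apply: eU'; rewrite /ball /= sub0r normrN.
exists e => //; split=> [k|t /eU' U't].
  exact: Ck_subset (Ck_line (F x) z (sF' k)).
have [UF' FF'] := F'K _ U't; apply: (MU _ UF').2 => i ni.
have z0 : z i 0 = 0 by rewrite EE ltnNge ni mul0r.
rewrite FF' mxE [X in _ + X]mxE z0 mulr0 addr0.
exact: (MU _ Ux).1.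
Unshelve. all: by end_near. Qed.

Lemma tangentZ (r : R) u : tangent M x u -> tangent M x (r *: u).
Proof.
have [A AE] := tangent_image; move=> /AE[c ->].
by apply/AE; exists (r *: c); rewrite scalemxAr.
Qed.

Lemma tangent_projection u : exists p, tangent M x p /\
  forall v, tangent M x v -> dot (u - p) v = 0.
Proof.
have [A AE] := tangent_image; have [c cE] := orthogonal_projection_mx A u.
exists (A *m c); split; first by apply/AE; exists c.
by move=> v /AE[e ->].
Qed.

Lemma tprojP u : tangent M x (tproj M x u) /\
  forall v, tangent M x v -> dot (u - tproj M x u) v = 0.
Proof. exact: (xgetPex 0 (tangent_projection u)). Qed.

(** Pythagoras: the difference of the squared norms is the squared norm of [u - p], which is
    orthogonal to [p]. *)
Lemma norm2_tproj_le u : norm2 (tproj M x u) <= norm2 u.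
Proof.
have [Tp /(_ _ Tp)] := tprojP u; set p := tproj M x u => up.
rewrite ler_wsqrtr// -subr_ge0.
have -> : dot u u - dot p p = dot (u - p) (u - p).
  by move: up; rewrite !(dotBl, dotBr) (dotC p u); lra.
exact: dot_ge0.
Qed.

(** Of the local smooth extension only differentiability at [x] is kept; it suffices for gradients
    and chain rules at [x], and passes to averages. *)
Definition has_extension (f : 'cV[R]_d -> R) := exists2 F : 'cV[R]_d -> R^o,
  differentiable F x & \forall y \near x, M y -> F y = f y.

(** On every curve through [x] with velocity [v], [f] and [F] agree near 0, so the derivative is the
    same for all curves. Tangency of [v] supplies a curve and excludes the default value of
    [xget]. *)
Lemma mdiff_extension f (F : 'cV[R]_d -> R^o) v :
  differentiable F x -> (\forall y \near x, M y -> F y = f y) ->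
  tangent M x v -> mdiff M f x v = 'd F x v.
Proof.
move=> dF Ff Tv; rewrite /mdiff.
have dfc c : curve_through M x v c ->
    is_derive (0 : R^o) (1 : R^o) (f \o c : R^o -> R^o) ('d F x v).
  move=> [[e e0 [_ Mc]] [c0 dc]].
  have cc : {for (0 : R^o), continuous c}.
    by apply: differentiable_continuous; apply/derivable1_diffP; exact: ex_derive.
  have dFc : is_derive (0 : R^o) (1 : R^o) (F \o c) ('d F x v).
    exact: is_derive_along.
  apply: near_eq_is_derive dFc; near=> t => /=.
  have Mct : M (c t) by apply: Mc; near: t; exact: (@nbhs0_lt _ R^o).
  move: Mct; near: t; apply: (cc [set y | M y -> F y = f y]).
  by rewrite c0.
case: xgetP => [l _ [c /dfc dc dl]|/(_ ('d F x v))[]].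
  by rewrite -(@derive_val _ _ _ _ _ _ _ dc) -(@derive_val _ _ _ _ _ _ _ dl).
by have [c vc] := Tv; exists c => //; exact: dfc.
Unshelve. all: by end_near. Qed.

Lemma mdiffZ f (r : R) v : has_extension f -> tangent M x v ->
  mdiff M f x (r *: v) = r * mdiff M f x v.
Proof.
move=> [F dF Ff] Tv; rewrite !(mdiff_extension dF Ff)//; last exact: tangentZ.
by rewrite linearZ.
Qed.

(** The gradient is the projection onto the tangent space of the vector representing the
    differential of an extension. *)
Lemma gradP f : has_extension f -> tangent M x (grad M f x) /\
  forall v, tangent M x v -> dot (grad M f x) v = mdiff M f x v.
Proof.
move=> [F dF Ff]; apply: (@xgetPex _ 0 [set g | tangent M x g /\
  forall v, tangent M x v -> dot g v = mdiff M f x v]).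
have [r rE] := linear_dot ('d F x); have [p [Tp pE]] := tangent_projection r.
exists p; split=> // v Tv; rewrite (mdiff_extension dF Ff)// rE.
by have := pE v Tv; rewrite dotBl => /eqP; rewrite subr_eq0 => /eqP.
Qed.

Lemma smooth_on_has_extension f :
  smooth_on M (f : 'cV[R]_d -> R^o) -> has_extension f.
Proof.
move=> /(_ x Mx)[U [F [oU Ux sF FE]]]; exists F.
  exact: smooth_differentiable sF Ux.
by near=> y; apply: FE; near: y; exact: open_nbhs_nbhs.
Unshelve. all: by end_near. Qed.

Lemma avg_fun_has_extension N (f : 'I_N -> 'cV[R]_d -> R) :
  (forall i, has_extension (f i)) -> has_extension (avg_fun f).
Proof.
move=> /(_ _)/cid2-/all_sig2[F dF FE].
exists (N%:R^-1 *: (\sum_(i < N) F i)).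
  by apply: differentiableZ; apply: differentiable_sum.
have FEn : \forall y \near x, forall i, M y -> F i y = f i y.
  exact: (@filter_forall _ _ (fun i y => M y -> F i y = f i y) _ (nbhs_filter x) FE).
near=> y => My; have FEy : forall i, M y -> F i y = f i y by near: y.
rewrite /avg_fun -[LHS]/(N%:R^-1 * (\sum_(i < N) F i) y) fct_sumE; congr (_ * _).
by apply: eq_bigr => i _; exact: FEy.
Unshelve. all: by end_near. Qed.

End Tangent.

(** With phi(t) = f(R_y(tv)), the mean value theorem gives f(R_y(v)) - f(y) = phi'(c) for some c in
    ]0, 1[. The hypothesis at cv reads |c phi'(c) - c <grad f(y), v>| <= L c^2 |v|^2; dividing by c
    and using c < 1 concludes. *)
Lemma descent (R : realType) d n (M : set 'cV[R]_d)
    (hM : embedded_submanifold n M) (f : 'cV[R]_d -> R)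
    (hf : forall x, M x -> has_extension M x f)
    (Rt : 'cV[R]_d -> 'cV[R]_d -> 'cV[R]_d) (hRt : retraction M Rt) (L : R) (L0 : 0 < L)
    (hL : forall y v, M y -> tangent M y v ->
      `| 'D_v (fun u => f (Rt y u) : R^o) v - mdiff M f y v | <= L * norm2 v ^+ 2)
    (y v : 'cV[R]_d) :
  M y -> tangent M y v ->
  f (Rt y v) <= f y + dot (grad M f y) v + L * norm2 v ^+ 2.
Proof.
move=> My Tv.
pose phi (t : R) : R := f (Rt y (t *: v)).
have Ttv t : tangent_bundle M (y, t *: v).
  by split=> //; exact: (tangentZ hM My).
have Mtv t : M (Rt y (t *: v)) by apply: (retr_in hRt).
(* [f] and [Rt] are controlled only on M and TM, so [phi] is compared near [t] with the composite of
   their local extensions; [(y, s *: v)] stays in TM for every [s]. *)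
have dphi (t : R) : derivable (phi : R^o -> R^o) t 1.
  apply/derivable1_diffP.
  have [U [Rx [oU Ut sRx RxE]]] := retr_smooth hRt (Ttv t).
  have [F dF FE] := hf _ (Mtv t).
  have dl : differentiable (fun s : R^o => (y, s *: v)) t.
    by apply: differentiable_pair; exact: ex_diff.
  have dR : differentiable (fun s : R^o => Rx (y, s *: v)) t.
    exact: (differentiable_comp dl (smooth_differentiable sRx Ut)).
  have RE : Rx (y, t *: v) = Rt y (t *: v) by rewrite RxE.
  have dFR : differentiable (fun s : R^o => F (Rx (y, s *: v))) t.
    by apply: (differentiable_comp dR); rewrite RE.
  have Un : \forall s \near (t : R^o), U (y, s *: v).
    by apply: (differentiable_continuous dl); exact: open_nbhs_nbhs.
  have Fn : \forall s \near (t : R^o), M (Rx (y, s *: v)) ->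
      F (Rx (y, s *: v)) = f (Rx (y, s *: v)).
    have FE' : nbhs (Rx (y, t *: v)) [set z | M z -> F z = f z] by rewrite RE.
    exact: (differentiable_continuous dR FE').
  apply/derivable1_diffP.
  have /derivable1_diffP := dFR; apply: near_eq_derivable; near=> s.
  have Es : Rx (y, s *: v) = Rt y (s *: v).
    by rewrite RxE//; near: s.
  rewrite /phi -Es; have Ms : M (Rx (y, s *: v)) by rewrite Es.
  by move: Ms; near: s.
have [c c01] : exists2 c : R, c \in `]0, 1[ & phi 1 - phi 0 = 'D_1 phi c * (1 - 0).
  apply: MVT => //; last by apply: derivable_within_continuous => t _; exact: dphi.
rewrite subr0 mulr1 {1}/phi scale1r {1}/phi scale0r (retr0 hRt)// => phiE.
have c0 : 0 < c by move: c01; rewrite in_itv => /andP[].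
have c1 : c < 1 by move: c01; rewrite in_itv => /andP[].
have := hL y (c *: v) My (Ttv c).2.
have -> : 'D_(c *: v) (fun u => f (Rt y u) : R^o) (c *: v) = c * 'D_1 phi c.
  transitivity ('D_c (phi : R^o -> R^o) c).
    have := derive_line (fun u => f (Rt y u) : R^o) 0 v c c.
    rewrite add0r => <-; congr ('D_c _ c).
    by apply/funext => t; rewrite add0r.
  rewrite deriveE; last exact/derivable1_diffP.
  by rewrite (deriv1E (dphi c)) derive1E.
have fE := hf y My; rewrite (mdiffZ hM My)// -(gradP hM My fE).2//.
rewrite norm2Z => /ler_normlW; rewrite -mulrBr.
rewrite expr2 mulrCA -mulrA ler_pM2l// => /le_trans le1.
have : c * (L * norm2 v ^+ 2) <= L * norm2 v ^+ 2.
  rewrite mulrA ler_wpM2r ?sqr_ge0//.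
  by rewrite ger_pMl// ltW.
by move=> /le1; lra.
Unshelve. all: by end_near. Qed.

(** * Finite-valued random variables *)

Section FiniteRandomVariable.
Context {dT : measure_display} {T : measurableType dT} {R : realType}.
Variable P : probability T R.

Definition pmf (E : finType) (X : T -> E) (e : E) : R :=
  fine (P (X @^-1` [set e])).

Section Law.
Context {E : finType} (X : T -> E).
Hypothesis mX : forall e, measurable (X @^-1` [set e]).

Lemma pmfE e : (pmf X e)%:E = P (X @^-1` [set e]).
Proof. by rewrite /pmf fineK// fin_num_measure. Qed.

Lemma pmf_ge0 e : 0 <= pmf X e.
Proof. by rewrite -lee_fin pmfE. Qed.

Lemma expectation_finite (z : E -> R) :
  'E_P[fun w => z (X w)]%E = (\sum_e pmf X e * z e)%:E.
Proof.
rewrite unlock.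
have -> : (fun w => (z (X w))%:E) =
    (fun w => \sum_(e <- index_enum E) (z e)%:E * (\1_(X @^-1` [set e]) w)%:E)%E.
  apply/funext => w; under eq_bigr do rewrite -EFinM.
  rewrite sumEFin (bigD1 (X w))//= big1 ?addr0 => [|e eX].
    by rewrite indicE mem_set ?mulr1.
  by rewrite indicE memNset ?mulr0//= => /esym/eqP; exact/negP.
have intX e : P.-integrable setT (fun w => (\1_(X @^-1` [set e]) w)%:E).
  exact: integrable_indic.
rewrite integral_sum//=; last by move=> e; exact: integrableZl.
rewrite -sumEFin; apply: eq_bigr => e _.
by rewrite integralZl// integral_indic// setIT EFinM pmfE muleC.
Qed.

(** A fibre of nonzero probability is not contained in a null set. This turns almost sure statements
    into statements about the values of [X]. *)
Lemma pmf_ae (Q : set T) e : pmf X e != 0 -> (\forall w \ae P, Q w) ->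
  exists2 w, X w = e & Q w.
Proof.
move=> + Qae; apply: contra_neqP => /forall2NP noQ.
apply/EFin_inj; rewrite pmfE; apply: measure_negligible => //.
by apply: negligibleS Qae => w /= Xw; have [] := noQ w.
Qed.

Lemma expectation_finite_ae_le (y z : E -> R) :
  (\forall w \ae P, y (X w) <= z (X w)) ->
  \sum_e pmf X e * y e <= \sum_e pmf X e * z e.
Proof.
move=> yz; apply: ler_sum => e _.
have [->|pe] := eqVneq (pmf X e) 0; first by rewrite !mul0r.
by have [w <- le] := pmf_ae pe yz; rewrite ler_wpM2l// pmf_ge0.
Qed.

End Law.

(** Stands in for measurability with respect to [X], without naming the factor map. *)
Definition determined_by (E A : Type) (X : T -> E) (Z : T -> A) :=
  forall w w', X w = X w' -> Z w = Z w'.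

Lemma determined_byP (E : Type) (A : pointedType) (X : T -> E) (Z : T -> A) :
  determined_by X Z -> exists z, Z = z \o X.
Proof.
(* Outside the range of [X] the factor takes the default value [point], which the composite never
   sees. *)
move=> det; exists (fun e => xget point [set a | exists2 w, X w = e & Z w = a]).
apply/funext => w /=; case: xgetP => [a _ [w' /det <- <-//]|/(_ (Z w))[]].
by exists w.
Qed.

Definition mean (Z : T -> R) : R := fine 'E_P[Z]%E.

Section Mean.
Context {E : finType} (X : T -> E).
Hypothesis mX : forall e, measurable (X @^-1` [set e]).

Lemma mean_comp (z : E -> R) : mean (z \o X) = \sum_e pmf X e * z e.
Proof. by rewrite /mean (expectation_finite mX). Qed.

Lemma mean_cst (c : R) : mean (cst c) = c.
Proof. by rewrite /mean expectation_cst. Qed.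

Lemma mean_le_ae (Y Z : T -> R) : determined_by X Y -> determined_by X Z ->
  (\forall w \ae P, Y w <= Z w) -> mean Y <= mean Z.
Proof.
move=> /determined_byP[y ->] /determined_byP[z ->] yz.
by rewrite !mean_comp; exact: expectation_finite_ae_le.
Qed.

Lemma meanZ (c : R) (Z : T -> R) : determined_by X Z ->
  mean (fun w => c * Z w) = c * mean Z.
Proof.
move=> /determined_byP[z ->].
rewrite (_ : (fun w => _) = (fun e => c * z e) \o X)// !mean_comp mulr_sumr.
by apply: eq_bigr => e _; rewrite mulrCA.
Qed.

Lemma mean_sum (I : Type) (r : seq I) (Q : pred I) (Z : I -> T -> R) :
  (forall i, Q i -> determined_by X (Z i)) ->
  mean (fun w => \sum_(i <- r | Q i) Z i w) = \sum_(i <- r | Q i) mean (Z i).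
Proof.
move=> det.
have {}det i : exists z, Q i -> Z i = z \o X.
  have [Qi|_] := boolP (Q i); last by exists (fun=> 0).
  by have [z ->] := determined_byP (det i Qi); exists z.
have [z zE] := choice det.
have -> : (fun w => \sum_(i <- r | Q i) Z i w) =
    (fun e => \sum_(i <- r | Q i) z i e) \o X.
  by apply/funext => w /=; apply: eq_bigr => i Qi; rewrite zE.
rewrite mean_comp; under eq_bigr do rewrite mulr_sumr.
rewrite exchange_big; apply: eq_bigr => i Qi.
by rewrite zE// mean_comp.
Qed.

End Mean.

(* For finite-valued [X] and [Y] this is E[u(X,Y)] = E[E_Y[u(X,Y)]]. *)
Lemma mean_indep (E F : finType) (X : T -> E) (Y : T -> F)
    (u : E -> F -> R) (c : E -> R) :
  (forall e, measurable (X @^-1` [set e])) ->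
  (forall f, measurable (Y @^-1` [set f])) ->
  (forall e f, P (X @^-1` [set e] `&` Y @^-1` [set f]) =
               (P (X @^-1` [set e]) * P (Y @^-1` [set f]))%E) ->
  (\forall w \ae P, mean (fun w' => u (X w) (Y w')) = c (X w)) ->
  mean (fun w => u (X w) (Y w)) = mean (fun w => c (X w)).
Proof.
move=> mX mY XY uc.
have XYE e f : (fun w => (X w, Y w)) @^-1` [set (e, f)] =
    X @^-1` [set e] `&` Y @^-1` [set f].
  by apply/seteqP; split=> w /= [-> ->].
have mXY ef : measurable ((fun w => (X w, Y w)) @^-1` [set ef]).
  by case: ef => e f; rewrite XYE; exact: measurableI.
rewrite (mean_comp mX c).
rewrite (mean_comp mXY (fun ef => u ef.1 ef.2)).
transitivity (\sum_e \sum_f pmf X e * pmf Y f * u e f).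
  rewrite pair_big; apply: eq_bigr => -[e f] _ /=; congr (_ * _).
  by apply/EFin_inj; rewrite EFinM !pmfE// XYE XY.
apply: eq_bigr => e _; under eq_bigr do rewrite -mulrA.
(* Values [e] of probability zero contribute nothing; any other is attained at some [w] where the
   almost sure identity holds. *)
rewrite -mulr_sumr; have [->|pe] := eqVneq (pmf X e) 0; first by rewrite !mul0r.
by have [w <- <-] := pmf_ae mX pe uc; rewrite (mean_comp mY (u (X w))).
Qed.

End FiniteRandomVariable.

(** * Asymptotics, batches and histories *)

(** Induction with ln q <= q - 1 at q = (K+1)/(K+2), which gives 1/(K+2) = 1 - q <= ln(K+2) -
    ln(K+1). *)
Lemma harmonic_le_ln (R : realType) K :
  \sum_(1 <= k < K.+2) (k%:R^-1 : R) <= 1 + ln K.+1%:R.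
Proof.
elim: K => [|K IHK]; first by rewrite big_nat1 invr1 ln1 addr0.
rewrite big_nat_recr//=; have K1 : 0 < K.+1%:R :> R by rewrite ltr0n.
have K2 : 0 < K.+2%:R :> R by rewrite ltr0n.
have KE : K.+2%:R^-1 = 1 - K.+1%:R / K.+2%:R :> R.
  have -> : K.+1%:R = K.+2%:R - 1 :> R by rewrite -[K.+2]addn1 natrD addrK.
  by rewrite mulrBl divff ?gt_eqF// mul1r opprB addrC subrK.
have := @le_ln1Dx R (K.+1%:R / K.+2%:R - 1).
rewrite [1 + _]addrC subrK lnM ?lnV ?posrE ?invr_gt0//.
have : 0 < K.+1%:R / K.+2%:R :> R by rewrite divr_gt0.
move=> q0 /(_ _)-/implyP; rewrite ltrBDr addNr q0/= => le1.
rewrite KE; move: IHK le1; move: (_ / _) (ln _) (ln _) (\sum_(_ <= _ < _) _).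
by move=> q l l' S; lra.
Qed.

(** The hypothesis controls the terms from [e 2] on, so [e 1] is added separately. Once ln K >= 1,
    all constants are absorbed into the logarithm. *)
Lemma bigO_lnK_sqrtK (R : realType) (e : nat -> R) (C0 C1 mu c : R) :
  0 < mu -> 0 <= C1 -> 1 <= c -> (forall k, 0 <= e k) ->
  (forall K, mu / Num.sqrt K.+1%:R * \sum_(1 <= k < K.+1) e k.+1 <=
             C0 + C1 * \sum_(1 <= k < K.+2) k%:R^-1) ->
  (fun K : nat => K%:R^-1 * \sum_(1 <= k < K.+1) e k : R^o)
  =O_\oo (fun K : nat => c * (ln K%:R / Num.sqrt K%:R) : R^o).
Proof.
move=> mu0 C1_ge0 c1 e0 eK; apply/eqOP; near=> Q => /=.
(* The factor 2 comes from [C1 * (1 + ln K) <= 2 * C1 * ln K]. *)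
have QC0 : e 1%N + (`|C0| + 2 * C1) / mu <= Q.
  by near: Q; apply: nbhs_pinfty_ge; exact: num_real.
suff key K : 1 <= ln K.+1%:R :> R ->
    `|K.+1%:R^-1 * \sum_(1 <= k < K.+2) e k| <=
    Q * `|c * (ln K.+1%:R / Num.sqrt K.+1%:R)|.
  near=> K; have K0 : (0 < K)%N by near: K; exact: nbhs_infty_gt.
  rewrite -(prednK K0); apply: key; rewrite prednK//.
  rewrite -[leLHS]expRK ler_ln ?posrE ?expR_gt0 ?ltr0n//.
  by near: K; exact: nbhs_infty_ger.
move=> lnK.
have K1 : 1 <= K.+1%:R :> R by rewrite ler1n.
have K0 : 0 < K.+1%:R :> R by rewrite ltr0n.
set s := Num.sqrt K.+1%:R.
have s1 : 1 <= s by rewrite -[leLHS]sqrtr1 ler_wsqrtr.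
have s0 : 0 < s by exact: lt_le_trans s1.
have sE : K.+1%:R = s * s by rewrite -expr2 sqr_sqrtr// ltW.
have sum0 : 0 <= \sum_(1 <= k < K.+2) e k by rewrite sumr_ge0.
have lnK0 : 0 <= ln K.+1%:R :> R by exact: le_trans lnK.
have c0 : 0 <= c by exact: le_trans c1.
rewrite (@ger0_norm _ (_ * \sum_(_ <= _ < _) _)); last first.
  by rewrite mulr_ge0// invr_ge0 ltW.
rewrite (@ger0_norm _ (c * _)); last by rewrite mulr_ge0// divr_ge0// ltW.
have le1 : \sum_(1 <= k < K.+2) e k <= e 1%N + s * ((C0 + C1 * (1 + ln K.+1%:R)) / mu).
  rewrite big_ltn// lerD2l big_add1/=.
  rewrite mulrA ler_pdivlMr// [leLHS]mulrC -ler_pdivrMl// mulrA [_^-1 * _]mulrC.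
  apply: le_trans (eK K) _; rewrite lerD2l ler_wpM2l//.
  exact: harmonic_le_ln.
have le2 : C0 + C1 * (1 + ln K.+1%:R) <= (`|C0| + 2 * C1) * ln K.+1%:R.
  have : C0 <= `|C0| * ln K.+1%:R.
    by apply: le_trans (ler_norm _) _; rewrite ler_peMr.
  have : C1 <= C1 * ln K.+1%:R by rewrite ler_peMr.
  by rewrite mulrDr mulrDl; lra.
have le3 : \sum_(1 <= k < K.+2) e k <= s * ln K.+1%:R * Q.
  apply: le_trans le1 _; apply: (@le_trans _ _ (s * ln K.+1%:R *
    (e 1%N + (`|C0| + 2 * C1) / mu))); last first.
    by rewrite ler_pM2l// mulr_gt0// (lt_le_trans _ lnK).
  rewrite [leRHS]mulrDr lerD//; first by rewrite ler_peMl// mulr_ege1.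
  rewrite -[leRHS]mulrA ler_pM2l// [leRHS]mulrA ler_pM2r ?invr_gt0//.
  by rewrite [leRHS]mulrC.
rewrite ler_pdivrMl// [X in _ <= X * _]sE.
apply: le_trans le3 _.
have Q0 : 0 <= Q.
  apply: le_trans QC0; rewrite addr_ge0// divr_ge0 ?(ltW mu0)// addr_ge0//.
  by rewrite mulr_ge0.
have -> : s * s * (Q * (c * (ln K.+1%:R * s^-1))) = c * (s * ln K.+1%:R * Q).
  by field; rewrite gt_eqF.
by rewrite ler_peMl// !mulr_ge0// ltW.
Unshelve. all: by end_near. Qed.

Section History.
Context {dT : measure_display} {T : measurableType dT} {R : realType}.
Variables (P : probability T R) (b N : nat) (s : nat -> 'I_b -> T -> 'I_N).

Definition batch k w : {ffun 'I_b -> 'I_N} := [ffun i => s k i w].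

(** Finite functions between finite types form a finite type, so means over a history are finite
    sums. Ordinals start at 0, hence the shift to the batches 1, ..., K. *)
Definition history K w : {ffun 'I_K -> {ffun 'I_b -> 'I_N}} :=
  [ffun i : 'I_K => batch i.+1 w].

Lemma history_batch K w w' k : history K w = history K w' ->
  (0 < k <= K)%N -> batch k w = batch k w'.
Proof.
case: k => // k /ffunP h kK.
by have := h (Ordinal kK); rewrite !ffunE.
Qed.

Lemma batchE k w i : batch k w i = s k i w.
Proof. by rewrite ffunE. Qed.

Lemma history_leq K K' w w' : (K' <= K)%N ->
  history K w = history K w' -> history K' w = history K' w'.
Proof.
move=> KK h; apply/ffunP => i; rewrite !ffunE.
by apply: (history_batch h) => //=; rewrite (leq_trans _ KK).
Qed.

Hypothesis hs_meas : forall k i j, (0 < k)%N -> measurable (s k i @^-1` [set j]).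

Lemma measurable_batch k t : (0 < k)%N -> measurable (batch k @^-1` [set t]).
Proof.
move=> k0; rewrite (_ : _ @^-1` _ = \bigcap_i (s k i @^-1` [set t i])).
  by apply: fin_bigcap_measurable => // i _; exact: hs_meas.
apply/seteqP; split=> [w /= <- i _|w tw]; first by rewrite /= ffunE.
by apply/ffunP => i; rewrite ffunE tw.
Qed.

Lemma measurable_history K h : measurable (history K @^-1` [set h]).
Proof.
rewrite (_ : _ @^-1` _ = \bigcap_(i : 'I_K) (batch i.+1 @^-1` [set h i])).
  by apply: fin_bigcap_measurable => // i _; exact: measurable_batch.
apply/seteqP; split=> [w /= <- i _|w hw]; first by rewrite /= ffunE.
by apply/ffunP => i; rewrite ffunE hw.
Qed.

Hypothesis hs_indep : independent_family P [set k | (0 < k)%N] batch.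

(** Both the history event and its intersection with the next batch event are intersections of batch
    events; mutual independence is applied to {1, ..., K} and to {1, ..., K+1}. *)
Lemma history_indep K h t :
  P (history K @^-1` [set h] `&` batch K.+1 @^-1` [set t]) =
  (P (history K @^-1` [set h]) * P (batch K.+1 @^-1` [set t]))%E.
Proof.
pose J := seq_fset tt (iota 1 K).
have JE k : (k \in J) = (0 < k <= K)%N by rewrite seq_fsetE mem_iota; lia.
have KJ : K.+1 \notin J by rewrite JE ltnn andbF.
(* For [1 <= k <= K] the condition reduces to the single value of [h] at [k - 1], without building
   an ordinal from [k]. *)
pose A k := if k == K.+1 then [set t] else
  [set u | forall i : 'I_K, i.+1 = k -> u = h i].
have AJ : \bigcap_(k in [set` J]) (batch k @^-1` A k) = history K @^-1` [set h].
  apply/seteqP; split=> [w Aw|w /= hw k /=].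
    apply/ffunP => i; rewrite ffunE.
    have := Aw i.+1; rewrite /= JE ltnS ltn_ord => /(_ isT).
    by rewrite /A eqSS ltn_eqF// => /(_ i erefl).
  rewrite JE => /andP[k0 kK]; rewrite /A ltn_eqF ?ltnS// => i <-.
  by rewrite -hw ffunE.
have AJ1 : \bigcap_(k in [set` (K.+1 |` J)%fset]) (batch k @^-1` A k) =
    history K @^-1` [set h] `&` batch K.+1 @^-1` [set t].
  rewrite -AJ; apply/seteqP; split=> [w Aw|w [Aw tw] k /=].
    split=> [k kJ|]; first by apply: Aw => /=; rewrite in_fsetU kJ orbT.
    by have := Aw K.+1; rewrite /= in_fsetU in_fset1 eqxx /A eqxx; apply.
  rewrite in_fsetU in_fset1 => /orP[/eqP ->|kJ]; last exact: Aw.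
  by rewrite /A eqxx.
have J0 k : k \in J -> (0 < k)%N by rewrite JE => /andP[].
rewrite -AJ1 hs_indep; last first.
  by move=> k /=; rewrite in_fsetU in_fset1 => /orP[/eqP ->//|/J0].
rewrite big_fsetU1//= -(@hs_indep J A J0).
by rewrite AJ /A eqxx muleC.
Qed.

End History.

(** * The adaptive scheme *)

Lemma minibatch_grad_dot (R : realType) d N b (M : set 'cV[R]_d)
    (f : 'I_N -> 'cV[R]_d -> R) (idx : 'I_b -> 'I_N) v y :
  dot v (minibatch_grad M f idx y) =
  b%:R^-1 * \sum_(i < b) \sum_(j < d) v j 0 * grad M (f (idx i)) y j 0.
Proof.
rewrite dotZr dotE; congr (_ * _).
under eq_bigr do rewrite summxE mulr_sumr.
by rewrite exchange_big.
Qed.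

(** With [v] and [y] frozen, linearity reduces the claim to coordinatewise unbiasedness, and the [b]
    equal terms cancel the factor [b%:R^-1]. *)
Lemma mean_minibatch_grad (dT : measure_display) (T : measurableType dT)
    (R : realType) (P : probability T R) d N b (M : set 'cV[R]_d)
    (f : 'I_N -> 'cV[R]_d -> R) (idx : T -> {ffun 'I_b -> 'I_N}) v y (u : 'cV[R]_d) :
  (0 < b)%N -> (forall t, measurable (idx @^-1` [set t])) ->
  (forall (i : 'I_b) j, mean P (fun w => grad M (f (idx w i)) y j 0) = u j 0) ->
  mean P (fun w => dot v (minibatch_grad M f (idx w) y)) = dot v u.
Proof.
move=> b0 midx gu; under [fun w => _]funext do rewrite minibatch_grad_dot.
have det A (F : {ffun 'I_b -> 'I_N} -> A) :
    determined_by idx (fun w => F (idx w)).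
  by move=> w w' /= ->.
rewrite (meanZ P midx); last first.
  exact: (det _ (fun t => \sum_(i < b) \sum_(j < d) v j 0 * grad M (f (t i)) y j 0)).
rewrite (mean_sum P midx) => [|i _]; last first.
  exact: (det _ (fun t => \sum_(j < d) v j 0 * grad M (f (t i)) y j 0)).
have E (i : 'I_b) :
    mean P (fun w => \sum_(j < d) v j 0 * grad M (f (idx w i)) y j 0) = dot v u.
  rewrite (mean_sum P midx) => [|j _]; last first.
    exact: (det _ (fun t => v j 0 * grad M (f (t i)) y j 0)).
  rewrite dotE; apply: eq_bigr => j _.
  rewrite (meanZ P midx) ?gu//.
  exact: (det _ (fun t : {ffun 'I_b -> 'I_N} => grad M (f (t i)) y j 0)).
under eq_bigr do rewrite E.
by rewrite sumr_const card_ord -(mulr_natl (dot v u)) mulKf// pnatr_eq0 -lt0n.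
Qed.

Section Scheme.
Context {R : realType} {d n N b : nat} {dT : measure_display}
  {T : measurableType dT}.
Variables (M : set 'cV[R]_d)
  (f : 'I_N -> 'cV[R]_d -> R) (Rt : 'cV[R]_d -> 'cV[R]_d -> 'cV[R]_d)
  (s : nat -> 'I_b -> T -> 'I_N) (alpha : nat -> R)
  (phi : forall k, ('I_k -> 'cV[R]_d) -> ('I_k -> 'cV[R]_d) -> 'cV[R]_d)
  (psi : forall k, ('I_k -> 'cV[R]_d) -> ('I_k -> 'cV[R]_d) -> 'M[R]_d)
  (x1 : 'cV[R]_d) (x g m : nat -> T -> 'cV[R]_d) (H : nat -> T -> 'M[R]_d).
Hypothesis hscheme : adaptive_scheme M f Rt alpha phi psi s x1 x g m H.

Local Notation gradf k w := (grad M (avg_fun f) (x k w)).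
Local Notation A k w := (invmx (H k w)).

(** The first [K] batches determine one more iterate than gradients and preconditioners. This shift
    makes [x k.+1] and [H k] independent of batch [k.+1]. *)
Lemma scheme_determined K :
  (forall k, (0 < k <= K.+1)%N -> determined_by (history s K) (x k)) /\
  (forall k, (0 < k <= K)%N ->
    determined_by (history s K) (g k) /\ determined_by (history s K) (H k)).
Proof.
elim: K => [|K [IHx IHgH]].
  split=> [[|[|k]]// _ w w' _|[]//].
  by rewrite !(scheme_init hscheme).
have xd k : (0 < k <= K.+1)%N -> determined_by (history s K.+1) (x k).
  by move=> kK w w' /(history_leq (leqnSn K)); exact: IHx.
have gd k : (0 < k <= K.+1)%N -> determined_by (history s K.+1) (g k).
  move=> kK w w' ww'; have k0 : (0 < k)%N by case/andP: kK.
  rewrite !(scheme_g hscheme)// (xd k kK w w' ww'); congr minibatch_grad.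
  by apply/funext => i; rewrite -!batchE (history_batch ww' kK).
have xsE k w w' : history s K.+1 w = history s K.+1 w' -> (k <= K.+1)%N ->
    (fun i : 'I_k => x i.+1 w) = (fun i : 'I_k => x i.+1 w').
  move=> ww' kK; apply/funext => i; apply: (xd i.+1) => //=.
  exact: leq_trans (ltn_ord i) kK.
have gsE k w w' : history s K.+1 w = history s K.+1 w' -> (k <= K.+1)%N ->
    (fun i : 'I_k => g i.+1 w) = (fun i : 'I_k => g i.+1 w').
  move=> ww' kK; apply/funext => i; apply: (gd i.+1) => //=.
  exact: leq_trans (ltn_ord i) kK.
have Hd k : (0 < k <= K.+1)%N -> determined_by (history s K.+1) (H k).
  move=> /andP[k0 kK] w w' ww'; rewrite !(scheme_H hscheme)//.
  by rewrite (xsE k w w')// (gsE k w w').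
split=> [k /andP[k0]|k kK]; last by split; [exact: gd|exact: Hd].
rewrite leq_eqVlt => /predU1P[->|kK]; last by apply: xd; rewrite k0.
move=> w w' ww'.
rewrite (scheme_x hscheme w (ltn0Sn K)) (scheme_x hscheme w' (ltn0Sn K)).
rewrite !(scheme_m hscheme)//.
rewrite (xsE K.+1 w w' ww' (leqnn _)) (gsE K.+1 w w' ww' (leqnn _)).
have K1 : (0 < K.+1 <= K.+1)%N by rewrite leqnn.
by rewrite (xd K.+1 K1 w w' ww') (Hd K.+1 K1 w w' ww').
Qed.

Hypothesis hM : embedded_submanifold n M.
Hypothesis hf : forall i, smooth_on M (f i : 'cV[R]_d -> R^o).
Hypothesis hRt : retraction M Rt.
Hypothesis hx1 : M x1.

Lemma scheme_in k w : (0 < k)%N -> M (x k w).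
Proof.
elim: k => // -[_ _|k IHk _]; first by rewrite (scheme_init hscheme).
have {}IHk := IHk isT.
rewrite (scheme_x hscheme)//; apply: (retr_in hRt); split=> //=.
by apply: (tangentZ hM IHk); exact: (tprojP hM IHk _).1.
Qed.

Let avg_extension y : M y -> has_extension M y (avg_fun f).
Proof.
by move=> My; apply: avg_fun_has_extension => i; exact: smooth_on_has_extension.
Qed.

Variables (L G B nu : R).
Hypotheses (hL0 : 0 < L) (hB : 0 < B) (hnu : 0 < nu).
Hypothesis hA4 : forall y v, M y -> tangent M y v ->
  `| 'D_v (fun u => avg_fun f (Rt y u) : R^o) v - mdiff M (avg_fun f) y v |
  <= L * norm2 v ^+ 2.
Hypothesis halpha0 : forall k, (0 < k)%N -> 0 < alpha k.

(** Bound on the preconditioned gradients: [d%:R ^+ 2] comes from [psdmx_norm2_le], [d%:R * nu]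
    bounds the trace, and [B] bounds the mini-batch gradient. *)
Let D := d%:R ^+ 2 * (d%:R * nu) * B.

Lemma preconditioned_norm2_le (C : 'M[R]_d) v : psdmx C -> loewner_le C nu%:M ->
  norm2 v <= B -> norm2 (C *m v) <= D.
Proof.
move=> Cpsd Cnu vB; apply: le_trans (psdmx_norm2_le _ Cpsd) _.
rewrite ler_pM ?norm2_ge0 ?mulr_ge0 ?sqr_ge0 ?psdmx_tr_ge0//.
by rewrite ler_wpM2l ?sqr_ge0// loewner_le_scalar_tr.
Qed.

(** The gradient is tangent, so the projection disappears from the inner product; in the quadratic
    term it can only shorten the step. *)
Lemma scheme_descent k w : (0 < k)%N -> m k w = g k w ->
  psdmx (A k w) -> loewner_le (A k w) nu%:M -> norm2 (g k w) <= B ->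
  avg_fun f (x k.+1 w) <= avg_fun f (x k w)
    - alpha k * dot (gradf k w) (A k w *m g k w) + L * D ^+ 2 * alpha k ^+ 2.
Proof.
move=> k0 mg Apsd Anu gB; have Mx := scheme_in w k0.
have a0 := halpha0 k0; have [Tp projE] := tprojP hM Mx (A k w *m g k w).
have [Tgrad _] := gradP hM Mx (avg_extension Mx).
rewrite (scheme_x hscheme)// mg.
apply: le_trans (descent hM avg_extension hRt hL0 hA4 Mx (tangentZ hM Mx _ Tp)) _.
have -> : dot (gradf k w) (- alpha k *: tproj M (x k w) (A k w *m g k w)) =
    - (alpha k * dot (gradf k w) (A k w *m g k w)).
  rewrite dotZr mulNr; congr (- (_ * _)); apply/esym/eqP.
  by have := projE _ Tgrad; rewrite dotC dotBr => /eqP; rewrite subr_eq0.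
rewrite lerD2l norm2Z sqrrN -mulrA ler_pM2l// mulrC ler_wpM2r ?sqr_ge0//.
rewrite lerXn2r ?nnegrE ?norm2_ge0//.
  by rewrite /D !mulr_ge0 ?exprn_ge0 ?ler0n ?(ltW hnu) ?(ltW hB).
apply: le_trans (norm2_tproj_le hM Mx _) _.
exact: preconditioned_norm2_le.
Qed.

(** At the first step there is no earlier preconditioner to trade for, so the inner product is
    bounded in absolute value by [D * G]. *)
Lemma scheme_first_step w : m 1%N w = g 1%N w ->
  psdmx (A 1%N w) -> loewner_le (A 1%N w) nu%:M ->
  norm2 (gradf 1%N w) <= G -> norm2 (g 1%N w) <= B ->
  avg_fun f (x 2%N w) <=
    avg_fun f x1 + alpha 1%N * (D * G) + L * D ^+ 2 * alpha 1%N ^+ 2.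
Proof.
move=> mg Apsd Anu gradG gB; have a0 : 0 < alpha 1%N by exact: halpha0.
have := scheme_descent (ltn0Sn 0) mg Apsd Anu gB.
rewrite (scheme_init hscheme) => /le_trans; apply; rewrite lerD2r lerD2l -mulrN.
rewrite ler_pM2l// (le_trans (ler_norm _))// normrN.
apply: le_trans (psdmx_dot_le _ _ Apsd) _.
rewrite (_ : D * G = d%:R ^+ 2 * (d%:R * nu) * G * B); last by rewrite /D; ring.
rewrite ler_pM ?mulr_ge0 ?exprn_ge0 ?norm2_ge0 ?psdmx_tr_ge0//.
rewrite ler_pM ?mulr_ge0 ?exprn_ge0 ?norm2_ge0 ?psdmx_tr_ge0//.
  by rewrite ler_wpM2l ?exprn_ge0// loewner_le_scalar_tr.
by rewrite -(scheme_init hscheme w).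
Qed.

(* H_k depends on the k-th batch; trading it for H_{k-1}, which does not,
   costs a term that telescopes because alpha_k H_k^{-1} is nonincreasing. *)
Lemma scheme_decrease k w : (0 < k)%N -> m k.+1 w = g k.+1 w ->
  psdmx (A k w) -> psdmx (A k.+1 w) -> loewner_le (A k.+1 w) nu%:M ->
  loewner_le (alpha k.+1 *: A k.+1 w) (alpha k *: A k w) ->
  norm2 (gradf k.+1 w) <= G -> norm2 (g k.+1 w) <= B ->
  alpha k * dot (A k w *m gradf k.+1 w) (g k.+1 w) <=
    (avg_fun f (x k.+1 w) - avg_fun f (x k.+2 w))
    + d%:R ^+ 2 * G * B * (alpha k * \tr (A k w) - alpha k.+1 * \tr (A k.+1 w))
    + L * D ^+ 2 * alpha k.+1 ^+ 2.
Proof.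
move=> k0 mg Ak Ak1 Anu Amono gradG gB.
have := scheme_descent (ltn0Sn k) mg Ak1 Anu gB.
(* The replacement error is the bilinear form of the positive semidefinite difference [alpha k *: A
   k w - alpha k.+1 *: A k.+1 w], whose trace is [t] below. *)
have := psdmx_dot_le (gradf k.+1 w) (g k.+1 w) Amono.
rewrite mulmxBl dotBr -!scalemxAl !dotZr [\tr _]raddfB /= !mxtraceZ.
rewrite -(psdmx_dot_mulmx _ _ Ak).
set t := alpha k * \tr _ - _.
have t0 : 0 <= t.
  by have := psdmx_tr_ge0 Amono; rewrite raddfB /= !mxtraceZ.
have : d%:R ^+ 2 * t * norm2 (gradf k.+1 w) * norm2 (g k.+1 w) <=
    d%:R ^+ 2 * G * B * t.
  rewrite (_ : _ * G * B * t = d%:R ^+ 2 * t * (G * B)); last by ring.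
  by rewrite -mulrA ler_wpM2l ?mulr_ge0 ?exprn_ge0// ler_pM ?norm2_ge0.
by rewrite ler_norml => + /andP[_]; lra.
Qed.

Hypothesis hb0 : (0 < b)%N.
Variable P : probability T R.
Hypothesis hs_meas : forall k i j, (0 < k)%N -> measurable (s k i @^-1` [set j]).
Hypothesis hs_indep : independent_family P [set k | (0 < k)%N] (batch s).
Hypothesis hA1 : forall k (i : 'I_b), (0 < k)%N -> \forall w \ae P,
  forall j : 'I_d,
  'E_P[fun w' => (grad M (f (s k i w')) (x k w) j 0)%R]%E = (gradf k w j 0)%:E.

(** [A k] and [x k.+1] depend on the first [k] batches only, so they can be frozen while averaging
    over batch [k.+1]; unbiasedness then replaces the mini-batch gradient by the full one. *)
Lemma mean_preconditioned_dot k : (0 < k)%N ->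
  mean P (fun w => dot (A k w *m gradf k.+1 w) (g k.+1 w)) =
  mean P (fun w => dot (A k w *m gradf k.+1 w) (gradf k.+1 w)).
Proof.
move=> k0; have [xd gHd] := scheme_determined k.
have k1k : (0 < k.+1 <= k.+1)%N by rewrite leqnn.
have kk : (0 < k <= k)%N by rewrite k0 leqnn.
have [xz xE] := determined_byP (xd _ k1k).
have [Hz HE] := determined_byP (gHd _ kk).2.
pose v h := invmx (Hz h) *m grad M (avg_fun f) (xz h).
pose u h (t : {ffun 'I_b -> 'I_N}) := dot (v h) (minibatch_grad M f t (xz h)).
pose c h := dot (v h) (grad M (avg_fun f) (xz h)).
transitivity (mean P (fun w => u (history s k w) (batch s k.+1 w))).
  congr mean; apply/funext => w.
  rewrite (scheme_g hscheme)// xE HE /=; congr dot.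
  by congr minibatch_grad; apply/funext => i; rewrite batchE.
transitivity (mean P (fun w => c (history s k w))); last first.
  by congr mean; apply/funext => w; rewrite xE HE.
apply: mean_indep => [h|t|h t|].
- exact: measurable_history.
- exact: measurable_batch.
- exact: history_indep.
have : \forall w \ae P, forall i j,
    'E_P[fun w' => (grad M (f (s k.+1 i w')) (x k.+1 w) j 0)%R]%E =
    (gradf k.+1 w j 0)%:E.
  by apply: filter_forall => i; exact: hA1.
apply: filterS => w hw; apply: mean_minibatch_grad => // [t|i j].
  exact: measurable_batch.
transitivity (mean P (fun w' => grad M (f (s k.+1 i w')) (x k.+1 w) j 0)).
  by congr mean; apply/funext => w'; rewrite batchE xE.
by rewrite /mean hw /= xE.
Qed.

End Scheme.

(** * Pathwise summation, expectation and the resulting rate *)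

Theorem theorem3p6 (R : realType)
  (d n : nat) (M : set 'cV[R]_d) (hM : embedded_submanifold n M)
  (N : nat) (f : 'I_N -> 'cV[R]_d -> R)
  (hf : forall i, smooth_on M (f i : 'cV[R]_d -> R^o))
  (Rt : 'cV[R]_d -> 'cV[R]_d -> 'cV[R]_d) (hRt : retraction M Rt)
  (b : nat) (hb0 : (0 < b)%N) (hbN : (b <= N)%N)
  (dT : measure_display) (T : measurableType dT) (P : probability T R)
  (s : nat -> 'I_b -> T -> 'I_N)
  (hs_meas : forall k i j, (0 < k)%N -> measurable (s k i @^-1` [set j]))
  (hs_indep : independent_family P [set k | (0 < k)%N]
                (fun k w => [ffun i : 'I_b => s k i w]))
  (alpha : nat -> R) (halpha0 : forall k, (0 < k)%N -> 0 < alpha k)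
  (phi : forall k, ('I_k -> 'cV[R]_d) -> ('I_k -> 'cV[R]_d) -> 'cV[R]_d)
  (psi : forall k, ('I_k -> 'cV[R]_d) -> ('I_k -> 'cV[R]_d) -> 'M[R]_d)
  (hpsi : pd_diag_valued M psi)
  (x1 : 'cV[R]_d) (hx1 : M x1)
  (x g m : nat -> T -> 'cV[R]_d) (H : nat -> T -> 'M[R]_d)
  (hscheme : adaptive_scheme M f Rt alpha phi psi s x1 x g m H)
  (hs_past : forall k, (0 < k)%N ->
     independent_of_past P k (fun w => [ffun i : 'I_b => s k i w]) x)
  (hA1 : forall k (i : 'I_b), (0 < k)%N -> \forall w \ae P, forall j : 'I_d,
     'E_P[fun w' => (grad M (f (s k i w')) (x k w) j 0)%R]%E
     = (grad M (avg_fun f) (x k w) j 0)%:E)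
  (sigma : R) (hsigma : 0 < sigma)
  (hA2 : forall k (i : 'I_b), (0 < k)%N -> \forall w \ae P,
     ('E_P[fun w' => (norm2 (grad M (f (s k i w')) (x k w)
                             - grad M (avg_fun f) (x k w)) ^+ 2)%R]
      <= (sigma ^+ 2)%:E)%E)
  (G B : R) (hG : 0 < G) (hB : 0 < B)
  (hA3 : forall k, (0 < k)%N -> \forall w \ae P,
     norm2 (grad M (avg_fun f) (x k w)) <= G /\
     norm2 (minibatch_grad M f (fun i => s k i w) (x k w)) <= B)
  (L : R) (hL : 0 < L)
  (hA4 : forall y v, M y -> tangent M y v ->
     `| 'D_v (fun u => avg_fun f (Rt y u) : R^o) v - mdiff M (avg_fun f) y v |
     <= L * norm2 v ^+ 2)
  (fstar : R) (hA5 : forall y, M y -> fstar <= avg_fun f y)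
  (halpha_mono : forall k, (0 < k)%N -> alpha k.+1 <= alpha k)
  (hphi : forall k, (0 < k)%N -> \forall w \ae P,
     phi k (fun i => x i.+1 w) (fun i => g i.+1 w) = g k w)
  (hH_mono : forall k, (0 < k)%N -> \forall w \ae P,
     loewner_le (alpha k.+1 *: invmx (H k.+1 w)) (alpha k *: invmx (H k w)))
  (mu nu : R) (hmu : 0 < mu) (hnu : 0 < nu)
  (hH_bd : forall k, (0 < k)%N -> \forall w \ae P,
     loewner_le mu%:M (invmx (H k w)) /\ loewner_le (invmx (H k w)) nu%:M)
  (a : R) (ha0 : 0 < a) (ha1 : a <= 1)
  (halpha : forall k, (0 < k)%N -> alpha k = a / Num.sqrt k%:R) :
  (fun K : nat => K%:R^-1 * \sum_(1 <= k < K.+1)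
     fine 'E_P[fun w => (norm2 (grad M (avg_fun f) (x k w)) ^+ 2)%R]%E : R^o)
  =O_\oo (fun K : nat => (1 + b%:R^-1) * (ln K%:R / Num.sqrt K%:R) : R^o).
Proof.
pose A k w := invmx (H k w).
pose F k w := avg_fun f (x k w).
pose gradf k w := grad M (avg_fun f) (x k w).
pose e k := mean P (fun w => norm2 (gradf k w) ^+ 2).
pose D := d%:R ^+ 2 * (d%:R * nu) * B.
pose C := d%:R ^+ 2 * G * B.
(* [C1] is the coefficient of [1/k] in [L * D ^+ 2 * alpha k ^+ 2]. [C0] gathers the bound on the
   objective after the first step, [- fstar], and [C] times a bound on the first term of the
   telescoping trace. *)
pose C1 := L * D ^+ 2 * a ^+ 2.
pose C0 := avg_fun f x1 + alpha 1%N * (D * G) + L * D ^+ 2 * alpha 1%N ^+ 2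
  - fstar + C * (alpha 1%N * (d%:R * nu)).
have C_ge0 : 0 <= C by rewrite /C !mulr_ge0 ?exprn_ge0 ?(ltW hG) ?(ltW hB).
have C1_ge0 : 0 <= C1.
  by rewrite mulr_ge0 ?sqr_ge0// mulr_ge0 ?sqr_ge0// ltW.
(* [C0] and [C1] have no explicit dependence on [b]; a factor at least 1 only enlarges the bound. *)
have c_ge1 : 1 <= 1 + b%:R^-1 :> R by rewrite lerDl invr_ge0.
have e_ge0 k : 0 <= e k.
  by apply: fine_ge0; apply: expectation_ge0 => w; rewrite sqr_ge0.
apply: (@bigO_lnK_sqrtK _ e C0 C1 (mu * a)) => //; first exact: mulr_gt0.
move=> K; pose S : R := \sum_(1 <= k < K.+2) k%:R^-1.
(* Countably many almost sure conditions are merged into one event, on which the argument is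
   pathwise; index 0 is vacuous. *)
have good : \forall w \ae P, forall k, (0 < k)%N ->
    [/\ m k w = g k w, loewner_le mu%:M (A k w) /\ loewner_le (A k w) nu%:M,
        norm2 (gradf k w) <= G /\ norm2 (g k w) <= B &
        loewner_le (alpha k.+1 *: A k.+1 w) (alpha k *: A k w)].
  apply: ae_foralln => k; case: k => [|k]; first exact: aeW.
  near=> w => _; split.
  - by rewrite (scheme_m hscheme)//; near: w; exact: hphi.
  - by near: w; exact: hH_bd.
  - by rewrite (scheme_g hscheme)//; near: w; exact: hA3.
  - by near: w; exact: hH_mono.
have psd k w : loewner_le mu%:M (A k w) -> psdmx (A k w).
  by apply: loewner_le_scalar_psd; exact: ltW.
(* [p] is what the descent inequality controls pathwise, [q] is what dominates the squared gradient;
   they have the same mean. *)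
pose p k w := alpha k * dot (A k w *m gradf k.+1 w) (g k.+1 w).
pose q k w := alpha k * dot (A k w *m gradf k.+1 w) (gradf k.+1 w).
have sum_p : \forall w \ae P, \sum_(1 <= k < K.+1) p k w <= C0 + C1 * S.
  apply: filterS good => w good.
  pose tau k := alpha k * \tr (A k w).
  have tau_ge0 k : (0 < k)%N -> 0 <= tau k.
    move=> k0; have [_ [/psd Apsd _] _ _] := good k k0.
    by rewrite mulr_ge0 ?psdmx_tr_ge0// ltW// halpha0.
  (* Step [k] contributes [1/(k+1)], so the term [1/1] on the right is slack; it covers the empty
     sum at [J = 0]. *)
  have telescope J : \sum_(1 <= k < J.+1) p k w <=
      F 2%N w - F J.+2 w + C * (tau 1%N - tau J.+1)
      + C1 * \sum_(1 <= k < J.+2) k%:R^-1.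
    elim: J => [|J IHJ].
      by rewrite big_geq// !subrr mulr0 !add0r mulr_ge0// big_nat1 invr1.
    rewrite big_nat_recr//= [in leRHS]big_nat_recr//=.
    have [_ [/psd Apsd _] _ mono] := good J.+1 isT.
    have [mg [/psd Apsd1 Anu] [gradG gB] _] := good J.+2 isT.
    have := scheme_decrease hscheme hM hf hRt hx1 hL hB hnu hA4 halpha0
      (ltn0Sn J) mg Apsd Apsd1 Anu mono gradG gB.
    rewrite -/(p J.+1 w) -/(F J.+2 w) -/(F J.+3 w) -/D -/C -/(tau _) -/(tau _).
    rewrite (halpha J.+2)// expr_div_n sqr_sqrtr// [L * _ * _]mulrA -/C1.
    move=> /(lerD IHJ)/le_trans; apply; rewrite le_eqVlt; apply/predU1P; left.
    by ring.
  apply: le_trans (telescope K) _.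
  have [mg [/psd Apsd Anu] [gradG gB] _] := good 1%N isT.
  have := scheme_first_step hscheme hM hf hRt hx1 hL hB hnu hA4 halpha0
    mg Apsd Anu gradG gB.
  rewrite -/D -/(F 2%N w).
  have := hA5 _ (scheme_in hscheme hM hRt hx1 w (ltn0Sn K.+1)).
  rewrite -/(F K.+2 w).
  (* The last trace term is nonnegative and is dropped; the first is at most
     [alpha 1 * (d * nu)]. *)
  have : C * (tau 1%N - tau K.+1) <= C * (alpha 1%N * (d%:R * nu)).
    rewrite ler_wpM2l// lerBlDr ler_wpDr ?tau_ge0//.
    by rewrite ler_wpM2l ?loewner_le_scalar_tr// ltW// halpha0.
  by rewrite /C0 -/S; lra.
have det k : (0 < k <= K)%N ->
    [/\ determined_by (history s K.+1) (A k),
        determined_by (history s K.+1) (gradf k.+1) &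
        determined_by (history s K.+1) (g k.+1)].
  move=> /andP[k0 kK]; have [xd gHd] := scheme_determined hscheme K.+1.
  split=> w w' ww'.
  - rewrite /A; congr invmx; apply: (gHd k _).2 ww'.
    by rewrite k0 leqW.
  - by rewrite /gradf; congr grad; apply: (xd k.+1 _) ww'; rewrite ltnS leqW.
  - by apply: (gHd k.+1 _).1 ww'.
have mH h := measurable_history hs_meas (K := K.+1) h.
have pdet k : (0 < k <= K)%N -> determined_by (history s K.+1) (p k).
  move=> /det[Ad grd gd] w w' ww'.
  by rewrite /p (Ad _ _ ww') (grd _ _ ww') (gd _ _ ww').
have qdet k : (0 < k <= K)%N -> determined_by (history s K.+1) (q k).
  move=> /det[Ad grd gd] w w' ww'.
  by rewrite /q (Ad _ _ ww') (grd _ _ ww').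
(* [mean_sum] asks for determinacy of the terms selected by the filter only, so the range of [k] is
   restated as a filter. *)
have sumE (h : nat -> R) : \sum_(1 <= k < K.+1 | (0 < k <= K)%N) h k =
    \sum_(1 <= k < K.+1) h k.
  rewrite big_nat_cond [RHS]big_nat.
  by apply: eq_bigl => k; rewrite ltnS andbb.
have mean_p : \sum_(1 <= k < K.+1) mean P (p k) <= C0 + C1 * S.
  rewrite -(mean_cst P (C0 + C1 * S)) -sumE -(mean_sum P mH)//.
  apply: (mean_le_ae mH) => //.
    by move=> w w' ww'; apply: eq_bigr => k /pdet; apply.
  by apply: filterS sum_p => w; rewrite sumE.
(* Since [k <= K.+1], the step size [alpha k] is at least [a / Num.sqrt K.+1%:R], and the lower
   bound [mu] on [A k] turns [q k] into a multiple of the squared gradient norm. *)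
have mean_q k : (0 < k <= K)%N ->
    mu * a / Num.sqrt K.+1%:R * e k.+1 <= mean P (p k).
  move=> kK; have [Ad grd gd] := det _ kK; have /andP[k0 kK'] := kK.
  have -> : mean P (p k) = mean P (q k).
    rewrite (meanZ P mH) ?(meanZ P mH).
    + congr (_ * _).
      exact: (mean_preconditioned_dot hscheme hb0 hs_meas hs_indep hA1).
    + by move=> w w' ww'; rewrite (Ad _ _ ww') (grd _ _ ww').
    + by move=> w w' ww'; rewrite (Ad _ _ ww') (grd _ _ ww') (gd _ _ ww').
  have grd2 : determined_by (history s K.+1) (fun w => norm2 (gradf k.+1 w) ^+ 2).
    by move=> w w' ww'; rewrite (grd _ _ ww').
  rewrite -(meanZ P mH)//; apply: (mean_le_ae mH); last 1 first.
  + apply: filterS good => w /(_ k k0)[_ [Amu _] _ _].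
    rewrite /q dotC (_ : mu * a / _ * _ =
      (a / Num.sqrt K.+1%:R) * (mu * norm2 (gradf k.+1 w) ^+ 2)); last by ring.
    rewrite ler_pM//.
    * by rewrite divr_ge0 ?sqrtr_ge0// ltW.
    * by rewrite mulr_ge0 ?sqr_ge0// ltW.
    * rewrite halpha// ler_pM2l// lef_pV2 ?posrE ?sqrtr_gt0 ?ltr0n//.
      by rewrite ler_wsqrtr// ler_nat leqW.
    * exact: loewner_le_scalar_dot.
  + by move=> w w' ww'; rewrite (grd _ _ ww').
  + exact: qdet.
apply: le_trans mean_p; rewrite mulr_sumr; apply: ler_sum_nat => k kK.
exact: mean_q.
Unshelve. all: by end_near. Qed.
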